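(* Let $\varphi:\mathbb{R}^n\to\mathbb{R}$ be of class $\mathcal C^{1,1}$ on a neighborhood of $\bar x$, where $\bar x$ is a tilt-stable local minimizer of $\varphi$ with modulus $\kappa>0$, and suppose there is $\delta>0$ such that for every $(x,v)\in\operatorname{gph}\nabla\varphi\cap\mathbb B_\delta(\bar x,0)$ the function $\varphi$ is twice epi-differentiable at $x$ for $v=\nabla\varphi(x)$. Then for every $x$ sufficiently close to $\bar x$, the problem $$\text{minimize}\ \ \varphi(x)+\langle\nabla\varphi(x),w\rangle+\tfrac12{\rm d}^2\varphi(x,\nabla\varphi(x))(w)\quad\text{over } w\in\mathbb{R}^n$$ admits a unique optimal solution.
   Context: $\mathcal C^{1,1}$ near $\bar x$: differentiable with locally Lipschitz gradient near $\bar x$. Second subderivative: ${\rm d}^2\varphi(x,v)(w)=\liminf_{t\downarrow0,w'\to w}\Delta_t^2\varphi(x,v)(w')$, where $\Delta_t^2\varphi(x,v)(w')=\frac{\varphi(x+tw')-\varphi(x)-t\langle v,w'\rangle}{t^2/2}$. $\varphi$ is twice epi-differentiable at $x$ for $v$ if for every $w$ and every $t_k\downarrow0$ there exists $w_k\to w$ with $\Delta_{t_k}^2\varphi(x,v)(w_k)\to{\rm d}^2\varphi(x,v)(w)$. $\bar x$ is a tilt-stable local minimizer of $\varphi$ with modulus $\kappa>0$ if for some $\gamma>0$ the mapping $M_\gamma(v)=\operatorname{argmin}\{\varphi(x)-\langle v,x\rangle:x\in\mathbb B_\gamma(\bar x)\}$ is single-valued and Lipschitz continuous with constant $\kappa$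 on a neighborhood of $0$, with $M_\gamma(0)=\{\bar x\}$. *)

(* Defs.v *)
From HB Require Import structures.
From mathcomp Require Import all_boot all_order all_algebra.
From mathcomp Require Import all_classical all_reals all_analysis.
Set Implicit Arguments. Unset Strict Implicit. Unset Printing Implicit Defensive.
Import Order.TTheory GRing.Theory Num.Theory.
Import numFieldNormedType.Exports.
Local Open Scope classical_set_scope.
Local Open Scope ring_scope.

Section Defs.
Context {R : realType} {n : nat}.
Notation V := 'rV[R]_n.

Definition dotp (u v : V) : R := \sum_(i < n) u ord0 i * v ord0 i.
Definition enorm (u : V) : R := Num.sqrt (dotp u u).

Definition is_gradient (f : V -> R) (x g : V) : Prop :=
  forall e : R, 0 < e -> exists d : R, 0 < d /\
    forall h : V, enorm h < d -> `|f (x + h) - f x - dotp g h| <= e * enorm h.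

Definition C11_near (f : V -> R) (xb : V) (G : V -> V) : Prop :=
  exists r : R, 0 < r /\
    (forall x, enorm (x - xb) < r -> is_gradient f x (G x)) /\
    (forall x, enorm (x - xb) < r -> exists s L : R, 0 < s /\
        forall y z, enorm (y - x) < s -> enorm (z - x) < s ->
          enorm (G y - G z) <= L * enorm (y - z)).

Definition sdiff (f : V -> R) (x v : V) (t : R) (w : V) : R :=
  (f (x + t *: w) - f x - t * dotp v w) / (t ^+ 2 / 2).

(* second subderivative: liminf_{t ↓ 0, w' -> w} Delta_t^2 f(x,v)(w') *)
Definition d2 (f : V -> R) (x v : V) (w : V) : \bar R :=
  ereal_sup [set y | exists e : R, 0 < e /\
    y = ereal_inf [set z | exists (t : R) (w' : V),
          0 < t /\ t < e /\ enorm (w' - w) < e /\ z = (sdiff f x v t w')%:E]].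

Definition twice_epi (f : V -> R) (x v : V) : Prop :=
  forall (w : V) (t : nat -> R), (forall k, 0 < t k) -> t @ \oo --> 0 ->
    exists wk : nat -> V, wk @ \oo --> w /\
      (fun k => (sdiff f x v (t k) (wk k))%:E) @ \oo --> d2 f x v w.

Definition argmin_ball (f : V -> R) (xb : V) (gamma : R) (v x : V) : Prop :=
  enorm (x - xb) <= gamma /\
  forall y, enorm (y - xb) <= gamma -> f x - dotp v x <= f y - dotp v y.

Definition tilt_stable (f : V -> R) (xb : V) (kappa : R) : Prop :=
  0 < kappa /\ exists gamma rho : R, 0 < gamma /\ 0 < rho /\
    (forall v, enorm v < rho -> exists! x, argmin_ball f xb gamma v x) /\
    (forall v1 v2 x1 x2, enorm v1 < rho -> enorm v2 < rho ->
       argmin_ball f xb gamma v1 x1 -> argmin_ball f xb gamma v2 x2 ->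
       enorm (x1 - x2) <= kappa * enorm (v1 - v2)) /\
    (forall x, argmin_ball f xb gamma 0 x <-> x = xb).

Definition subprob (f : V -> R) (x v w : V) : \bar R :=
  ((f x + dotp v w)%:E + (2^-1)%:E * d2 f x v w)%E.

End Defs.

(* Main.v *)
(** Tilt stability makes the conjugate of [phi] (plus the indicator of the ball) of class C^{1,1} near 0,
    with gradient the argmin map [M]; dually, [phi] satisfies the uniform growth
    [phi z >= phi x + <v, z - x> + |z - x|^2 / (4 kappa)] at every [x = M v].  Every [x0] near [xb]
    is of this form with [v = G x0]: minimizing the conjugate minus [<., x0>] over a small ball
    of tilts gives, by the growth at [M v] and the Lipschitz continuity of [G], an interior minimizer
    [v0], and first-order optimality reads [M v0 = x0].  Hence the second-order difference quotients
    of [phi] at [x] are midpoint strongly convex and locally Lipschitz, uniformly in [t]; by twice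
    epi-differentiability they converge pointwise to the second subderivative along any
    [t_k -> 0], so the second subderivative is finite, continuous and strongly convex. *)
Require Import Defs.
From HB Require Import structures.
From mathcomp Require Import all_boot all_order all_algebra.
From mathcomp Require Import all_classical all_reals all_analysis.
From mathcomp Require Import ring lra.
Import Order.TTheory GRing.Theory Num.Theory.
Import numFieldNormedType.Exports.
Local Open Scope classical_set_scope.
Local Open Scope ring_scope.

Set Implicit Arguments.
Unset Strict Implicit.

(** * Euclidean inner product and norm on row vectors, and minimization over closed balls *)

Section Euclidean.
Context {R : realType} {n : nat}.
Implicit Types u v w : 'rV[R]_n.

Lemma dotpC u v : dotp u v = dotp v u.
Proof. by apply: eq_bigr => i _; rewrite mulrC. Qed.

Lemma dotpDl u v w : dotp (u + v) w = dotp u w + dotp v w.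
Proof. by rewrite -big_split; apply: eq_bigr => i _; rewrite !mxE mulrDl. Qed.

Lemma dotpDr u v w : dotp w (u + v) = dotp w u + dotp w v.
Proof. by rewrite dotpC dotpDl !(dotpC w). Qed.

Lemma dotpZl (a : R) u v : dotp (a *: u) v = a * dotp u v.
Proof. by rewrite mulr_sumr; apply: eq_bigr => i _; rewrite !mxE mulrA. Qed.

Lemma dotpZr (a : R) u v : dotp u (a *: v) = a * dotp u v.
Proof. by rewrite dotpC dotpZl dotpC. Qed.

Lemma dotpNl u v : dotp (- u) v = - dotp u v.
Proof. by rewrite -scaleN1r dotpZl mulN1r. Qed.

Lemma dotpNr u v : dotp u (- v) = - dotp u v.
Proof. by rewrite dotpC dotpNl dotpC. Qed.

Lemma dotp0l u : dotp 0 u = 0.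
Proof. by rewrite -(scale0r 0) dotpZl mul0r. Qed.

Lemma dotp0r u : dotp u 0 = 0.
Proof. by rewrite dotpC dotp0l. Qed.

Definition dotpE := (dotpDl, dotpDr, dotpNl, dotpNr, dotpZl, dotpZr).

Lemma dotp_ge0 u : 0 <= dotp u u.
Proof. by apply: sumr_ge0 => i _; exact: sqr_ge0. Qed.

Lemma enorm_ge0 u : 0 <= enorm u.
Proof. exact: sqrtr_ge0. Qed.

Lemma sqr_enorm u : enorm u ^+ 2 = dotp u u.
Proof. exact/sqr_sqrtr/dotp_ge0. Qed.

Lemma coord_le_enorm u i : `|u ord0 i| <= enorm u.
Proof.
rewrite -sqrtr_sqr ler_sqrt ?dotp_ge0// /dotp (bigD1 i)//= expr2 lerDl.
by apply: sumr_ge0 => j _; exact: sqr_ge0.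
Qed.

Lemma enorm_eq0 u : enorm u <= 0 -> u = 0.
Proof.
move=> u0; apply/rowP => i; rewrite mxE; apply/eqP; rewrite -normr_le0.
exact: le_trans (coord_le_enorm u i) u0.
Qed.

Lemma enormZ (a : R) u : enorm (a *: u) = `|a| * enorm u.
Proof.
by rewrite /enorm dotpZl dotpZr mulrA -expr2 sqrtrM ?sqr_ge0// sqrtr_sqr.
Qed.

Lemma enormN u : enorm (- u) = enorm u.
Proof. by rewrite -scaleN1r enormZ normrN1 mul1r. Qed.

Lemma enormB u v : enorm (u - v) = enorm (v - u).
Proof. by rewrite -enormN opprB. Qed.

Lemma enorm0 : enorm (0 : 'rV[R]_n) = 0.
Proof. by rewrite /enorm dotp0l sqrtr0. Qed.

(** Cauchy-Schwarz: expand the nonnegative square of [enorm v *: u - enorm u *: v] and divide by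
    [enorm u * enorm v]; zero vectors are treated apart. *)
Lemma dotp_le u v : dotp u v <= enorm u * enorm v.
Proof.
have [u0|u0] := leP (enorm u) 0.
  by rewrite (enorm_eq0 u0) dotp0l enorm0 mul0r.
have [v0|v0] := leP (enorm v) 0.
  by rewrite (enorm_eq0 v0) dotp0r enorm0 mulr0.
have := dotp_ge0 (enorm v *: u - enorm u *: v).
rewrite !dotpE -!sqr_enorm (dotpC v u) => H.
rewrite -subr_ge0 -(pmulr_rge0 _ (mulr_gt0 u0 v0)); nra.
Qed.

Lemma dotp_ge u v : - (enorm u * enorm v) <= dotp u v.
Proof. by rewrite lerNl -dotpNl -(enormN u); exact: dotp_le. Qed.

Lemma enormD u v : enorm (u + v) <= enorm u + enorm v.
Proof.
rewrite -(@ler_pXn2r _ 2) ?nnegrE ?addr_ge0 ?enorm_ge0//.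
rewrite sqr_enorm !dotpE (dotpC v) sqrrD !sqr_enorm.
by have := dotp_le u v; lra.
Qed.

Lemma enorm_triangle w u v : enorm (u - v) <= enorm (u - w) + enorm (w - v).
Proof. by apply: le_trans (enormD _ _); rewrite addrA subrK. Qed.

(** The ambient topology comes from the sup norm [|u|]. With [coord_le_enorm] this comparison
    transfers convergence, closedness and continuity to [enorm]; the crude factor [n] suffices. *)
Lemma enorm_le_norm u : enorm u <= n%:R * `|u|.
Proof.
have coord i : `|u ord0 i| <= `|u|.
  rewrite [leRHS]/Num.norm/= mx_normrE.
  exact: (@le_bigmax _ _ _ 0 (fun ij => `|u ij.1 ij.2|) (ord0, i)).
rewrite -(@ler_pXn2r _ 2) ?nnegrE ?mulr_ge0 ?enorm_ge0//.
rewrite sqr_enorm exprMn.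
have -> : dotp u u = \sum_(i < n) `|u ord0 i| ^+ 2.
  by apply: eq_bigr => i _; rewrite real_normK ?num_real.
apply: (@le_trans _ _ (\sum_(i < n) `|u| ^+ 2)).
  by apply: ler_sum => i _; rewrite ler_pXn2r ?nnegrE.
rewrite sumr_const card_ord -[leLHS]mulr_natl ler_wpM2r ?sqr_ge0//.
by rewrite -natrX ler_nat; case: (n) => // m; rewrite leq_pmulr.
Qed.

Lemma cvg_enormB (wk : nat -> 'rV[R]_n) w :
  wk @ \oo --> w -> enorm (wk k - w) @[k --> \oo] --> 0.
Proof.
move=> wkw; apply: (@squeeze_cvgr _ _ _ _ (fun=> 0) (fun k => n%:R * `|wk k - w|)).
- by near=> k; rewrite enorm_ge0 enorm_le_norm.
- exact: cvg_cst.
- rewrite -[X in _ --> X](mulr0 n%:R) -(@normr0 _ 'rV[R]_n) -(subrr w).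
  by apply: cvgMl_tmp; apply: cvg_norm; apply: cvgB => //; exact: cvg_cst.
Unshelve. all: by end_near. Qed.

(** Weierstrass on the compact Euclidean ball. The one-sided estimate, required for all ordered
    pairs, yields continuity by exchanging [v] and [v']. The sign of [K] is free, whence [|K| + 1]
    in the proof. *)
Lemma lipschitz_min_ball (h : 'rV[R]_n -> R) (r K : R) : 0 <= r ->
  (forall v v', enorm v <= r -> enorm v' <= r -> h v - h v' <= K * enorm (v - v')) ->
  exists2 v0, enorm v0 <= r & forall v, enorm v <= r -> h v0 <= h v.
Proof.
move=> r0 hK; pose A : set 'rV[R]_n := [set v | enorm v <= r].
have [|||v0] := @EVT_min_rV R n h A.
- by exists 0; rewrite /A/= enorm0.
- apply: bounded_closed_compact.
    exists r; split; first exact: num_real.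
    move=> M rM v Av; rewrite /= [leLHS]/Num.norm/= mx_normrE; apply: bigmax_le => /=.
      exact: le_trans (ltW rM).
    move=> [i j] _; rewrite ord1 (le_trans (coord_le_enorm v j))//.
    exact: le_trans Av (ltW rM).
  move=> v clAv; rewrite /A/= leNgt; apply/negP => rv.
  (* A point [u] of the ball within sup-distance [d] of [v] would give
     [enorm (v - u) <= n * d < enorm v - r]. The [+ 1] makes this strict and keeps the denominator
     positive when [n = 0]. *)
  pose d := (enorm v - r) / (n%:R + 1).
  have d0 : 0 < d by rewrite divr_gt0 ?subr_gt0// ltr_wpDl.
  have [u [Au]] := clAv _ (nbhsx_ballx v d d0).
  rewrite -ball_normE /= => vud.
  have : enorm v <= enorm (v - u) + enorm u by rewrite -{1}(subrK u v) enormD.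
  have := enorm_le_norm (v - u).
  have : n%:R * `|v - u| <= n%:R * d by rewrite ler_wpM2l// ltW.
  have : d * (n%:R + 1) = enorm v - r by rewrite divfK// gt_eqF// ltr_wpDl.
  by move: Au; rewrite /A/=; lra.
- apply/subspace_continuousP => v Av; apply/cvgrPdist_lt => e e0.
  have K0 : 0 < (`|K| + 1) * (n%:R + 1) by rewrite mulr_gt0// ltr_wpDl.
  have near_v : \forall u \near v, `|v - u| < e / ((`|K| + 1) * (n%:R + 1)).
    apply/(@nbhs_normP R); exists (e / ((`|K| + 1) * (n%:R + 1))) => //=.
    by rewrite divr_gt0.
  rewrite near_withinE near_simpl; near=> u => Au.
  have H w w' : A w -> A w' -> h w - h w' <= (`|K| + 1) * (n%:R * `|w - w'|).
    move=> Aw Aw'; apply: le_trans (hK _ _ Aw Aw') _.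
    apply: le_trans (_ : (`|K| + 1) * enorm (w - w') <= _).
      by rewrite ler_wpM2r ?enorm_ge0//; have := ler_norm K; lra.
    by rewrite ler_wpM2l ?enorm_le_norm// addr_ge0.
  have : `|h v - h u| <= (`|K| + 1) * (n%:R * `|v - u|).
    by rewrite ler_norml H// andbT lerNl opprB distrC H.
  move=> /le_lt_trans; apply.
  have : `|v - u| < e / ((`|K| + 1) * (n%:R + 1)).
    by near: u.
  have := mulr_ge0 (addr_ge0 (normr_ge0 K) ler01) (normr_ge0 (v - u)).
  by rewrite ltr_pdivlMr//; lra.
- by rewrite inE => Av0 h0; exists v0 => // v Av; apply: h0; rewrite inE.
Unshelve. all: by end_near. Qed.
End Euclidean.

(** * Tilt stability: quadratic growth at the argmin points, which fill a neighborhood *)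

Section TiltStability.
Context {R : realType} {n : nat}.
Variables (f : 'rV[R]_n -> R) (a : 'rV[R]_n) (gamma rho kappa : R).
Hypothesis kappa0 : 0 < kappa.
Hypothesis argmin_ex :
  forall v, enorm v < rho -> exists x, argmin_ball f a gamma v x.
Hypothesis argmin_lip : forall v1 v2 x1 x2, enorm v1 < rho -> enorm v2 < rho ->
  argmin_ball f a gamma v1 x1 -> argmin_ball f a gamma v2 x2 ->
  enorm (x1 - x2) <= kappa * enorm (v1 - v2).

(* Test the minimality of [x'], the minimizer for the tilt [v'], at [z]: with
   [v' - v = (z - x) / (2 kappa)] the gain [<v' - v, z - x>] is twice the
   loss [<v' - v, x' - x> <= kappa |v' - v|^2]. *)
Lemma argmin_growth v x z : enorm v < rho -> argmin_ball f a gamma v x ->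
  enorm (z - a) <= gamma -> enorm (v + (2 * kappa)^-1 *: (z - x)) < rho ->
  f x + dotp v (z - x) + (4 * kappa)^-1 * enorm (z - x) ^+ 2 <= f z.
Proof.
move=> vrho xv za; set d := _ *: _ => v'rho.
have [x' x'v'] := argmin_ex v'rho.
have := argmin_lip v'rho vrho x'v' xv.
rewrite (addrC v) addrK => lipd.
have := xv.2 _ x'v'.1; have := x'v'.2 _ za.
have dN : enorm d = (2 * kappa)^-1 * enorm (z - x).
  by rewrite enormZ gtr0_norm// invr_gt0 mulr_gt0.
have gain : dotp d (z - x) = (2 * kappa)^-1 * enorm (z - x) ^+ 2.
  by rewrite dotpZl sqr_enorm.
have loss : dotp d (x' - x) <= (4 * kappa)^-1 * enorm (z - x) ^+ 2.
  apply: le_trans (dotp_le _ _) _.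
  apply: le_trans (ler_wpM2l (enorm_ge0 d) lipd) _.
  rewrite dN le_eqVlt; apply/orP; left; apply/eqP; field.
  by rewrite gt_eqF.
have : (2 * kappa)^-1 = 2 * (4 * kappa)^-1 by field; rewrite gt_eqF.
move=> eqk; move: gain loss; rewrite eqk !dotpE; lra.
Qed.

(** Fermat's rule at an interior minimizer: if [u = g - v] were nonzero, a step of length [m] along
    [- u] would change the tilted function by [- m * enorm u], up to an error of at most half that
    size. *)
Lemma argmin_gradient v x g : is_gradient f x g -> argmin_ball f a gamma v x ->
  enorm (x - a) < gamma -> g = v.
Proof.
move=> fg [_ xmin] xa; apply/eqP; rewrite -subr_eq0; apply/eqP.
apply: enorm_eq0; rewrite leNgt; apply/negP; set u := g - v => u0.
have [|d [d0 fd]] := fg (enorm u / 2); first by rewrite divr_gt0.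
have [m [m0 md mg]] : exists m, [/\ 0 < m, m < d & m <= gamma - enorm (x - a)].
  exists (Num.min (d / 2) (gamma - enorm (x - a))); split.
  - by rewrite lt_min subr_gt0 xa divr_gt0.
  - by rewrite gt_min; apply/orP; left; lra.
  - by rewrite ge_min lexx orbT.
pose h := - (m / enorm u) *: u.
have hN : enorm h = m.
  rewrite enormZ normrN gtr0_norm ?divr_gt0//.
  by rewrite divfK// gt_eqF.
have := fd h; rewrite hN => /(_ md); rewrite ler_norml => /andP[_ upper].
have xha : enorm (x + h - a) <= gamma.
  by rewrite addrAC; have := enormD (x - a) h; rewrite hN; lra.
have := xmin _ xha.
have uh : dotp g h - dotp v h = - (m * enorm u).
  rewrite -dotpNl -dotpDl dotpZr -sqr_enorm; field.
  by rewrite gt_eqF.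
rewrite dotpDr; have := mulr_gt0 m0 u0; lra.
Qed.

(** Every point near [a] is the minimizer for its own gradient as tilt. The bound [rho / 2] on that
    tilt leaves room for the perturbed tilt required by [argmin_growth]. *)
Lemma tilt_argmin_onto (G : 'rV[R]_n -> 'rV[R]_n) (r L : R) :
  0 < gamma -> 0 < rho -> 0 < r -> 0 < L ->
  (forall x, enorm (x - a) < r -> is_gradient f x (G x)) ->
  (forall x, enorm (x - a) < r -> enorm (G x - G a) <= L * enorm (x - a)) ->
  argmin_ball f a gamma 0 a ->
  exists2 eta, 0 < eta & forall x, enorm (x - a) < eta ->
    enorm (G x) < rho / 2 /\ argmin_ball f a gamma (G x) x.
Proof.
move=> gamma0 rho0 r0 L0 fG GL a0.
(* Tilts of size at most [rho1] have minimizers within [kappa * rho1] of [a]: interior to the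
   [gamma]-ball and in the region where [G] is the gradient, so that [G] inverts [M] there. *)
have [rho1 [rho10 rho1rho rho1r rho1g]] : exists rho1,
    [/\ 0 < rho1, rho1 < rho / 2, kappa * rho1 < r & kappa * rho1 < gamma].
  exists (Num.min (rho / 4) (Num.min r gamma / (2 * kappa))).
  set p := Num.min r gamma; set q := Num.min _ _.
  have p0 : 0 < p by rewrite lt_min r0.
  have [pr pg] : p <= r /\ p <= gamma by rewrite !ge_min !lexx orbT.
  have qp : kappa * q <= p / 2.
    have : q <= p / (2 * kappa) by rewrite ge_min lexx orbT.
    rewrite -(ler_pM2l kappa0); congr (_ <= _).
    by field; rewrite gt_eqF.
  have qr : q <= rho / 4 by rewrite ge_min lexx.
  by split; rewrite ?lt_min ?divr_gt0 ?mulr_gt0//; lra.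
have /choice[M MP] : forall v, exists x, enorm v < rho -> argmin_ball f a gamma v x.
  (* Outside the [rho]-ball [M] takes the arbitrary value 0. *)
  move=> v; have [vrho|_] := boolP (enorm v < rho); last by exists 0.
  by have [x xv] := argmin_ex vrho; exists x.
have lt_rho (v : 'rV[R]_n) : enorm v <= rho1 -> enorm v < rho by lra.
have Mlip v v' : enorm v <= rho1 -> enorm v' <= rho1 ->
    enorm (M v - M v') <= kappa * enorm (v - v').
  by move=> /lt_rho vr /lt_rho v'r; apply: argmin_lip; auto.
have n0 : enorm (0 : 'rV[R]_n) < rho by rewrite enorm0.
have Ma v : enorm v <= rho1 -> enorm (M v - a) <= kappa * enorm v.
  by move=> /lt_rho vr; have := argmin_lip vr n0 (MP _ vr) a0; rewrite subr0.
have Mrho1 v : enorm v <= rho1 -> enorm (M v - a) <= kappa * rho1.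
  by move=> vr; apply: le_trans (Ma _ vr) _; rewrite ler_pM2l.
have GM v : enorm v <= rho1 -> G (M v) = v.
  move=> vr; have Mr := Mrho1 _ vr.
  by apply: (argmin_gradient (fG _ _) (MP _ (lt_rho _ vr))); lra.
have Ga : G a = 0.
  by apply: (argmin_gradient (fG _ _) a0); rewrite subrr enorm0.
(* Since [enorm v = enorm (G (M v)) <= L * enorm (M v - a)], the growth
   [(4 * kappa)^-1 * enorm (M v - a) ^+ 2] is at least [c * enorm v ^+ 2]. *)
pose c := (4 * kappa)^-1 / L ^+ 2.
have c0 : 0 < c by rewrite divr_gt0 ?exprn_gt0// invr_gt0 mulr_gt0.
exists (rho1 * c); first by rewrite mulr_gt0.
move=> x0 x0a; set e := enorm (x0 - a) in x0a.
(* [h] is the conjugate of [f] restricted to the [gamma]-ball, minus the linear form [dotp v x0].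
   The estimate [h_sub] says that [M v - x0] is a subgradient of [h] at [v]. *)
pose h v := dotp v (M v - x0) - f (M v).
have h_sub v v' : enorm v <= rho1 -> enorm v' <= rho1 ->
    h v - h v' <= dotp (v - v') (M v - x0).
  move=> vr v'r; have := (MP _ (lt_rho _ v'r)).2 _ (MP _ (lt_rho _ vr)).1.
  by rewrite /h !dotpE; lra.
have [|v v'|v0 v0r hmin] := @lipschitz_min_ball R n h rho1 (kappa * rho1 + e).
- exact: ltW.
- move=> vr v'r; apply: le_trans (h_sub _ _ vr v'r) _.
  apply: le_trans (dotp_le _ _) _; rewrite mulrC ler_wpM2r ?enorm_ge0//.
  by apply: le_trans (enorm_triangle a _ _) _; rewrite lerD ?Mrho1// enormB.
(* The minimizer is interior: comparing [h v0 <= h 0] with the growth at [M v0] tested at [a] gives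
   [c * enorm v0 ^+ 2 <= dotp v0 (x0 - a) <= enorm v0 * e], while [e < rho1 * c]. *)
have v0lt : enorm v0 < rho1.
  rewrite ltNge; apply/negP => v0ge.
  have N0 : 0 < enorm v0 by lra.
  have := hmin 0; rewrite enorm0 /h dotp0l (_ : M 0 = a); last first.
    apply/eqP; rewrite -subr_eq0; apply/eqP/enorm_eq0.
    by apply: le_trans (Ma 0 _) _; rewrite enorm0 ?mulr0// ltW.
  move=> /(_ (ltW rho10)) hv0.
  have small : enorm (v0 + (2 * kappa)^-1 *: (a - M v0)) < rho.
    apply: le_lt_trans (enormD _ _) _.
    rewrite enormZ gtr0_norm ?invr_gt0 ?mulr_gt0// enormB.
    have : (2 * kappa)^-1 * enorm (M v0 - a) <= (2 * kappa)^-1 * (kappa * enorm v0).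
      by rewrite ler_pM2l ?Ma// invr_gt0 mulr_gt0.
    have -> : (2 * kappa)^-1 * (kappa * enorm v0) = enorm v0 / 2.
      by field; rewrite gt_eqF.
    by lra.
  have growth : c * enorm v0 ^+ 2 <= (4 * kappa)^-1 * enorm (a - M v0) ^+ 2.
    rewrite /c -mulrA ler_pM2l ?invr_gt0 ?mulr_gt0//.
    rewrite mulrC ler_pdivrMr ?exprn_gt0// -exprMn.
    rewrite ler_pXn2r ?nnegrE ?mulr_ge0 ?enorm_ge0 ?(ltW L0)//.
    have := GL (M v0); rewrite GM// Ga subr0 enormB mulrC; apply.
    by have := Mrho1 _ v0r; lra.
  have : dotp v0 (x0 - a) <= enorm v0 * e by exact: dotp_le.
  have : c * enorm v0 ^+ 2 <= enorm v0 * e -> False.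
    rewrite expr2 mulrCA ler_pM2l// => H.
    have : c * rho1 <= c * enorm v0 by rewrite ler_pM2l.
    by lra.
  have := argmin_growth (lt_rho _ v0r) (MP _ (lt_rho _ v0r)) a0.1 small.
  by move: hv0; rewrite !dotpE; lra.
have v0x0 : M v0 = x0.
  apply/esym/eqP; rewrite -subr_eq0; apply/eqP; apply: enorm_eq0.
  rewrite leNgt; apply/negP; set u := x0 - M v0 => u0.
  (* The first bound keeps [v0 + s *: u] in the ball. The second gives [kappa * s <= 1 / 2], so that
     by the Lipschitz bound on [M] moving from [v0] by [s *: u] lowers [h] by at least
     [s * enorm u ^+ 2 / 2], against minimality. *)
  pose s := Num.min ((rho1 - enorm v0) / enorm u) (kappa^-1 / 2).
  have s0 : 0 < s.
    by rewrite lt_min !divr_gt0 ?invr_gt0 ?subr_gt0.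
  have su : enorm (s *: u) <= rho1 - enorm v0.
    by rewrite enormZ gtr0_norm// -ler_pdivlMr// ge_min lexx.
  have ks : kappa * s <= 1 / 2.
    rewrite mulrC -ler_pdivlMr// ge_min; apply/orP; right.
    by rewrite mulrC mul1r.
  have v'r : enorm (v0 + s *: u) <= rho1.
    by apply: le_trans (enormD _ _) _; lra.
  have := h_sub _ _ v'r v0r; have := hmin _ v'r.
  have := Mlip _ _ v'r v0r.
  set x' := M _; rewrite !(addrC v0) !addrK enormZ (gtr0_norm s0) dotpZl => lip.
  have -> : x' - x0 = (x' - M v0) - u by rewrite /u opprB addrA subrK.
  rewrite dotpDr dotpNr -sqr_enorm.
  have : dotp u (x' - M v0) <= enorm u * (enorm u * (1 / 2)).
    apply: le_trans (dotp_le _ _) _; rewrite ler_pM2l//.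
    apply: le_trans lip _; rewrite mulrA (mulrC (enorm u)) ler_pM2r//.
  move=> H H1 H2; have : 0 <= s * (dotp u (x' - M v0) - enorm u ^+ 2) by lra.
  rewrite pmulr_rge0//; have := mulr_gt0 u0 u0; rewrite expr2; lra.
have v0G : G x0 = v0 by rewrite -v0x0 GM.
by rewrite v0G; split; [lra|rewrite -v0x0; apply/MP/lt_rho].
Qed.

End TiltStability.

(** Gathers the local data used afterwards, with [M] eliminated: growth and Lipschitz estimates
    stated through [G] alone, on one common ball. *)
Lemma tilt_stable_growth (R : realType) (n : nat) (f : 'rV[R]_n -> R) a G kappa :
  C11_near f a G -> tilt_stable f a kappa ->
  exists eta c L, [/\ 0 < eta, 0 < c, 0 < L & forall x, enorm (x - a) < eta ->
    [/\ is_gradient f x (G x), enorm (G x) <= L * enorm (x - a),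
     forall z, enorm (z - a) < eta -> enorm (G x - G z) <= L * enorm (x - z) &
     forall z, enorm (z - a) < eta ->
       f x + dotp (G x) (z - x) + c * enorm (z - x) ^+ 2 <= f z]].
Proof.
move=> [r [r0 [fG GL]]] [kappa0 [gamma [rho [gamma0 [rho0 [Mex [Mlip M0]]]]]]].
have [|s [L [s0 sL]]] := GL a; first by rewrite subrr enorm0.
have {}sL y z : enorm (y - a) < s -> enorm (z - a) < s ->
    enorm (G y - G z) <= (`|L| + 1) * enorm (y - z).
  move=> ys zs; apply: le_trans (sL _ _ ys zs) _.
  by rewrite ler_wpM2r ?enorm_ge0//; have := ler_norm L; lra.
have L0 : 0 < `|L| + 1 by rewrite ltr_wpDl.
have a0 : argmin_ball f a gamma 0 a by apply/M0.
have ex v : enorm v < rho -> exists x, argmin_ball f a gamma v x.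
  by move=> /Mex[x [vx _]]; exists x.
have rs0 : 0 < Num.min r s by rewrite lt_min r0.
have [||eta eta0 onto] := tilt_argmin_onto kappa0 ex Mlip gamma0 rho0 rs0 L0 (G := G) _ _ a0.
- by move=> x; rewrite lt_min => /andP[xr _]; exact: fG.
- by move=> x; rewrite lt_min => /andP[_ xs]; apply: sL; rewrite // subrr enorm0.
have Ga : G a = 0.
  by apply: (argmin_gradient (fG _ _) a0); rewrite subrr enorm0.
(* The bound [kappa * rho / 2] gives [enorm (z - x) < kappa * rho], so the shift
   [(2 * kappa)^-1 *: (z - x)] of the tilt stays below [rho / 2]; added to [G x] it remains below
   [rho]. *)
pose e := Num.min (Num.min eta gamma) (Num.min (Num.min r s) (kappa * rho / 2)).
have [e0 [e1 e2] [e3 e4 e5]] :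
    [/\ 0 < e, e <= eta /\ e <= gamma & [/\ e <= r, e <= s & e <= kappa * rho / 2]].
  by rewrite !lt_min !ge_min !lexx !orbT eta0 gamma0 r0 s0 divr_gt0 ?mulr_gt0.
exists e, (4 * kappa)^-1, (`|L| + 1); split => //.
  by rewrite invr_gt0 mulr_gt0.
move=> x xe; split.
- by apply: fG; lra.
- by have := sL x a; rewrite Ga subr0; apply; rewrite ?subrr ?enorm0; lra.
- by move=> z ze; apply: sL; lra.
move=> z ze; have [|Gxrho xG] := onto x; first lra.
apply: (argmin_growth kappa0 ex Mlip _ xG); [lra|lra|].
apply: le_lt_trans (enormD _ _) _.
rewrite enormZ gtr0_norm ?invr_gt0 ?mulr_gt0//.
have : (2 * kappa)^-1 * enorm (z - x) < (2 * kappa)^-1 * (kappa * rho).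
  rewrite ltr_pM2l ?invr_gt0 ?mulr_gt0//.
  by apply: le_lt_trans (enorm_triangle a _ _) _; rewrite (enormB a); lra.
have -> : (2 * kappa)^-1 * (kappa * rho) = rho / 2 by field; rewrite gt_eqF.
by lra.
Qed.

(** * Second-order difference quotients and their limits *)

Lemma near_harmonic_lt (R : realType) (b e : R) :
  0 < e -> \forall k \near \oo, harmonic k * b < e.
Proof.
move=> e0; have h0 : harmonic k * b @[k --> \oo] --> 0.
  by rewrite -[X in _ --> X](mul0r b); apply: cvgMr_tmp; exact: cvg_harmonic.
exact: (cvgr_lt _ h0).
Qed.

Section DifferenceQuotient.
Context {R : realType} {n : nat}.
Variables (f : 'rV[R]_n -> R) (G : 'rV[R]_n -> 'rV[R]_n) (a : 'rV[R]_n).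
Variables (eta c L : R).
Hypothesis c0 : 0 < c.
Hypothesis L0 : 0 < L.
Hypothesis G_lip : forall x z, enorm (x - a) < eta -> enorm (z - a) < eta ->
  enorm (G x - G z) <= L * enorm (x - z).
Hypothesis growth : forall x z, enorm (x - a) < eta -> enorm (z - a) < eta ->
  f x + dotp (G x) (z - x) + c * enorm (z - x) ^+ 2 <= f z.
Variable x : 'rV[R]_n.
Hypothesis xeta : enorm (x - a) < eta.

Let D := sdiff f x (G x).

Let in_ball t w : 0 < t -> t * enorm w < eta - enorm (x - a) ->
  enorm (x + t *: w - a) < eta.
Proof.
move=> t0 tw; rewrite addrAC; apply: le_lt_trans (enormD _ _) _.
by rewrite enormZ gtr0_norm//; lra.
Qed.

Let half_sqr_gt0 (t : R) : 0 < t -> 0 < t ^+ 2 / 2.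
Proof. by move=> t0; rewrite divr_gt0 ?exprn_gt0. Qed.

Lemma sdiff0 t : D t 0 = 0.
Proof. by rewrite /D /sdiff scaler0 addr0 dotp0r mulr0 !subrr mul0r. Qed.

Lemma sdiff_ge t w : 0 < t -> t * enorm w < eta - enorm (x - a) ->
  2 * c * enorm w ^+ 2 <= D t w.
Proof.
move=> t0 tw; rewrite ler_pdivlMr ?half_sqr_gt0//.
have := growth xeta (in_ball t0 tw).
by rewrite (addrC x) addrK dotpZr enormZ exprMn real_normK ?num_real//; lra.
Qed.

(** Growth at [x + t *: w] tested at [x + t *: w'] bounds the increment of [f] by the gradient at
    the first point. Subtracting [G x] costs [L * t * enorm w], and the factor [t ^+ 2] cancels,
    leaving a bound uniform in [t]. *)
Lemma sdiff_lip t w w' : 0 < t -> t * enorm w < eta - enorm (x - a) ->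
  t * enorm w' < eta - enorm (x - a) ->
  D t w - D t w' <= 2 * L * enorm w * enorm (w - w').
Proof.
move=> t0 /(in_ball t0) xw /(in_ball t0) xw'.
rewrite -mulrBl ler_pdivrMr ?half_sqr_gt0//.
have := growth xw xw'; have := G_lip xw xeta.
have -> : x + t *: w' - (x + t *: w) = - (t *: (w - w')).
  by rewrite opprD addrACA subrr add0r scalerBr opprB.
rewrite addrAC subrr add0r => lip grow.
have : 0 <= c * enorm (- (t *: (w - w'))) ^+ 2.
  by rewrite mulr_ge0 ?sqr_ge0// ltW.
have : dotp (G (x + t *: w) - G x) (t *: (w - w')) <=
    L * (t * enorm w) * (t * enorm (w - w')).
  apply: le_trans (dotp_le _ _) _; rewrite enormZ gtr0_norm//.
  rewrite ler_wpM2r ?mulr_ge0 ?enorm_ge0 ?(ltW t0)//.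
  by move: lip; rewrite enormZ gtr0_norm.
by move: grow; rewrite !dotpE; lra.
Qed.

(** Growth at the midpoint is tested at both endpoints. The linear terms are opposite and cancel;
    the two quadratic terms, at distance [t / 2 * enorm (w - w')], add up to the constant [c] after
    division by [t ^+ 2 / 2]. *)
Lemma sdiff_midpoint t w w' : 0 < t -> t * enorm w < eta - enorm (x - a) ->
  t * enorm w' < eta - enorm (x - a) ->
  2 * D t (2^-1 *: (w + w')) + c * enorm (w - w') ^+ 2 <= D t w + D t w'.
Proof.
move=> t0 tw tw'; set m := _ *: (w + w').
have tm : t * enorm m < eta - enorm (x - a).
  have : t * enorm m <= t * (2^-1 * (enorm w + enorm w')).
    by rewrite ler_pM2l// enormZ gtr0_norm// ler_pM2l// enormD.
  by move=> /le_lt_trans; apply; lra.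
have := growth (in_ball t0 tm) (in_ball t0 tw').
have := growth (in_ball t0 tm) (in_ball t0 tw).
have E1 : x + t *: w - (x + t *: m) = (t / 2) *: (w - w').
  by apply/rowP => i; rewrite !mxE; field.
have E2 : x + t *: w' - (x + t *: m) = - ((t / 2) *: (w - w')).
  by apply/rowP => i; rewrite !mxE; field.
rewrite E1 E2 enormN dotpNr enormZ exprMn real_normK ?num_real// => g1 g2.
have E3 : 2 * t * dotp (G x) m = t * dotp (G x) w + t * dotp (G x) w'.
  by rewrite dotpZr dotpDr; field.
rewrite -(ler_pM2r (half_sqr_gt0 t0)) !mulrDl -mulrA.
by rewrite /D /sdiff !divfK ?gt_eqF ?half_sqr_gt0//; lra.
Qed.

(** Twice epi-differentiability supplies a limit only along some [wk] converging to [w]; the uniform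
    bound [sdiff_lip] allows [wk] to be replaced by [w] itself. The single sequence [harmonic] then
    serves all directions at once. *)
Lemma d2_sdiff_lim w : twice_epi f x (G x) ->
  exists q, d2 f x (G x) w = q%:E /\ D (harmonic k) w @[k --> \oo] --> q.
Proof.
move=> epi; have h0 k : 0 < harmonic k :> R by rewrite invr_gt0.
have [wk [/cvg_enormB wkw]] := epi w harmonic h0 cvg_harmonic.
rewrite -/D => Dwk.
pose b := enorm w + 1.
have wk1 : \forall k \near \oo, enorm (wk k - w) < 1 by exact: (cvgr_lt _ wkw).
have wkb : \forall k \near \oo, enorm (wk k) <= b /\
    harmonic k * enorm (wk k) < eta - enorm (x - a).
  near=> k; have le_b : enorm (wk k) <= b.
    rewrite -(subrK w (wk k)); apply: le_trans (enormD _ _) _.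
    by rewrite addrC lerD2l ltW//; near: k.
  split=> //; apply: le_lt_trans (_ : _ <= harmonic k * b) _.
    by rewrite ler_pM2l.
  by near: k; apply: near_harmonic_lt; rewrite subr_gt0.
have w_small : \forall k \near \oo, harmonic k * enorm w < eta - enorm (x - a).
  by apply: near_harmonic_lt; rewrite subr_gt0.
have b1 : enorm w <= b by rewrite lerDl.
have b0 : 0 <= b by rewrite addr_ge0 ?enorm_ge0.
have Dwk_ge0 : (0%:E <= d2 f x (G x) w)%E.
  apply: cvge_to_ge Dwk _; apply: filterS wkb => k [_ /(sdiff_ge (h0 k)) Dk].
  rewrite lee_fin; apply: le_trans Dk.
  by rewrite mulr_ge0 ?sqr_ge0// mulr_ge0// ltW.
(* Comparison with the direction 0, where the quotient vanishes, bounds it above; with nonnegativity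
   this makes [d2] finite. *)
have Dwk_le : (d2 f x (G x) w <= (2 * L * b * b)%:E)%E.
  apply: cvge_to_le Dwk _; apply: filterS wkb => k [wk_b wk_s].
  rewrite lee_fin.
  have := sdiff_lip (h0 k) wk_s (_ : harmonic k * enorm 0 < _).
  rewrite enorm0 mulr0 subr_gt0 => /(_ xeta); rewrite sdiff0 !subr0.
  move=> /le_trans; apply; apply: ler_pM; rewrite ?mulr_ge0 ?enorm_ge0 ?(ltW L0)//.
  by rewrite ler_wpM2l// mulr_ge0 ?(ltW L0).
case E : (d2 f x (G x) w) Dwk_ge0 Dwk_le Dwk => [q| |]// _ _ Dwk.
exists q; split=> //.
have {}Dwk : D (harmonic k) (wk k) @[k --> \oo] --> q by exact: fine_cvg Dwk.
have diff : D (harmonic k) w - D (harmonic k) (wk k) @[k --> \oo] --> 0.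
  apply: (@squeeze_cvgr _ _ _ _ (fun k => - (2 * L * b * enorm (wk k - w)))
            (fun k => 2 * L * b * enorm (wk k - w))).
  - apply: filterS2 wkb w_small => k [wk_b wk_s] w_s.
    apply/andP; split.
      rewrite lerNl opprB; apply: le_trans (sdiff_lip (h0 k) wk_s _) _ => //.
      by rewrite ler_wpM2r ?enorm_ge0// ler_wpM2l// mulr_ge0 ?(ltW L0).
    apply: le_trans (sdiff_lip (h0 k) _ wk_s) _ => //.
    rewrite enormB.
    by rewrite ler_wpM2r ?enorm_ge0// ler_wpM2l// mulr_ge0 ?(ltW L0).
  - rewrite -oppr0; apply: cvgN.
    by rewrite -[X in _ --> X](mulr0 (2 * L * b)); apply: cvgMl_tmp.
  - by rewrite -[X in _ --> X](mulr0 (2 * L * b)); apply: cvgMl_tmp.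
rewrite -[X in _ --> X]add0r.
under eq_fun => k do rewrite -(subrK (D (harmonic k) (wk k)) (D (harmonic k) w)).
exact: cvgD diff Dwk.
Unshelve. all: by end_near. Qed.

End DifferenceQuotient.

(** * Strongly convex minimization and the subproblem *)

(** Existence follows from coercivity and compactness. For uniqueness, the midpoint of two distinct
    minimizers would have a strictly smaller value. *)
Lemma strongly_convex_unique_min (R : realType) (n : nat) (q : 'rV[R]_n -> R)
    (g : 'rV[R]_n) (c L : R) : 0 < c -> 0 < L -> q 0 = 0 ->
  (forall w, 2 * c * enorm w ^+ 2 <= q w) ->
  (forall w w', q w - q w' <= 2 * L * enorm w * enorm (w - w')) ->
  (forall w w', 2 * q (2^-1 *: (w + w')) + c * enorm (w - w') ^+ 2 <= q w + q w') ->
  exists! w, forall w', dotp g w + q w / 2 <= dotp g w' + q w' / 2.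
Proof.
(* Beyond radius [enorm g / c] the term [c * enorm w ^+ 2] dominates [enorm g * enorm w], so the
   objective is at least its value 0 at the origin, and a minimizer over the ball is global. *)
move=> c0 L0 q0 q_ge q_lip q_mid; pose r := enorm g / c.
have r0 : 0 <= r by rewrite divr_ge0 ?enorm_ge0// ltW.
pose p w := dotp g w + q w / 2.
have [w w' wr w'r|w0 w0r w0min] := @lipschitz_min_ball R n p r (enorm g + L * r) r0.
  have lip := q_lip w w'; have := dotp_le g (w - w').
  have : L * enorm w * enorm (w - w') <= L * r * enorm (w - w').
    by rewrite ler_wpM2r ?enorm_ge0// ler_pM2l.
  by rewrite /p dotpDr dotpNr; lra.
have {}w0min w : p w0 <= p w.
  have [/w0min//|rw] := leP (enorm w) r.
  apply: (@le_trans _ _ (p 0)); first by apply: w0min; rewrite enorm0.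
  rewrite /p dotp0r q0 mul0r addr0.
  have gw := dotp_ge g w; have qw := q_ge w.
  have : enorm g * enorm w <= c * enorm w * enorm w.
    by rewrite ler_wpM2r ?enorm_ge0// mulrC -ler_pdivrMr// ltW.
  by rewrite expr2 in qw; lra.
exists w0; split=> // w1 w1min; apply/eqP; rewrite -subr_eq0; apply/eqP/enorm_eq0.
have w01 : p w1 <= p w0 := w1min w0.
have w1mid := w1min (2^-1 *: (w0 + w1)).
have mid := q_mid w0 w1.
have gmid : dotp g (2^-1 *: (w0 + w1)) = (dotp g w0 + dotp g w1) / 2.
  by rewrite dotpZr dotpDr mulrC.
have : c * enorm (w0 - w1) ^+ 2 <= 0.
  by move: w01 (w0min w1); rewrite /p; lra.
rewrite pmulr_rle0// => N; rewrite leNgt; apply/negP => N0.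
by have := exprn_gt0 2 N0; lra.
Qed.

(** The bounds on the quotients, valid for each direction once [harmonic k] is small, pass to the
    pointwise limit [q]; the objective differs from that of the strongly convex problem by the
    constant [f x]. *)
Lemma d2_unique_min (R : realType) (n : nat) (f : 'rV[R]_n -> R) G a eta c L x :
  0 < c -> 0 < L ->
  (forall y z, enorm (y - a) < eta -> enorm (z - a) < eta ->
     enorm (G y - G z) <= L * enorm (y - z)) ->
  (forall y z, enorm (y - a) < eta -> enorm (z - a) < eta ->
     f y + dotp (G y) (z - y) + c * enorm (z - y) ^+ 2 <= f z) ->
  enorm (x - a) < eta -> twice_epi f x (G x) ->
  exists! w, forall w', (subprob f x (G x) w <= subprob f x (G x) w')%E.
Proof.
move=> c0 L0 G_lip growth xa epi.
have /choice[q qP] := fun w => d2_sdiff_lim c0 L0 G_lip growth xa w epi.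
pose D k := sdiff f x (G x) (harmonic k).
have lim w : D k w @[k --> \oo] --> q w by case: (qP w).
have h0 k : 0 < harmonic k :> R by rewrite invr_gt0.
have small (w : 'rV[R]_n) : \forall k \near \oo, harmonic k * enorm w < eta - enorm (x - a).
  by apply: near_harmonic_lt; rewrite subr_gt0.
have subprobE w : subprob f x (G x) w = (f x + (dotp (G x) w + q w / 2))%:E.
  by rewrite /subprob (qP w).1 -EFinM -EFinD addrA (mulrC (q w)).
have [|w|w w'|w w'|w0 [w0min w0uniq]] := strongly_convex_unique_min (q := q) (G x) c0 L0.
- apply: (cvg_unique _ (lim 0)) => //.
  rewrite (_ : (fun k => D k 0) = fun=> 0); first exact: cvg_cst.
  by apply/funext => k; rewrite /D sdiff0.
- apply: (ler_cvg_to (cvg_cst _) (lim w)); apply: filterS (small w) => k ws.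
  exact: (sdiff_ge growth xa).
- apply: (ler_cvg_to (cvgB (lim w) (lim w')) (cvg_cst _)).
  apply: filterS2 (small w) (small w') => k ws w's.
  exact: (sdiff_lip c0 G_lip growth xa (h0 k) ws w's).
- have liml : 2 * D k (2^-1 *: (w + w')) + c * enorm (w - w') ^+ 2 @[k --> \oo] -->
      2 * q (2^-1 *: (w + w')) + c * enorm (w - w') ^+ 2.
    by apply: cvgD; [apply: cvgM; [exact: cvg_cst|exact: lim]|exact: cvg_cst].
  apply: (ler_cvg_to liml (cvgD (lim w) (lim w'))).
  apply: filterS2 (small w) (small w') => k ws w's.
  exact: (sdiff_midpoint growth (h0 k) ws w's).
exists w0; split=> [w|w1 w1min]; first by rewrite !subprobE lee_fin lerD2l.
by apply: w0uniq => w; have := w1min w; rewrite !subprobE lee_fin lerD2l.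
Qed.

Unset Implicit Arguments.
Set Strict Implicit.

Theorem theorem5p3 (R : realType) (n : nat) (phi : 'rV[R]_n -> R)
  (xb : 'rV[R]_n) (G : 'rV[R]_n -> 'rV[R]_n) (kappa delta : R) :
  C11_near phi xb G ->
  tilt_stable phi xb kappa ->
  0 < delta ->
  (forall x v : 'rV[R]_n, is_gradient phi x v ->
     Num.sqrt (enorm (x - xb) ^+ 2 + enorm v ^+ 2) <= delta ->
     twice_epi phi x v) ->
  exists eps : R, 0 < eps /\
    forall x : 'rV[R]_n, enorm (x - xb) < eps ->
      exists! w : 'rV[R]_n, forall w' : 'rV[R]_n,
        (subprob phi x (G x) w <= subprob phi x (G x) w')%E.
Proof.
move=> C11 tilt delta0 epi.
have [eta [c [L [eta0 c0 L0 near_xb]]]] := tilt_stable_growth C11 tilt.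
have L1 : 0 < L + 1 by rewrite addr_gt0.
(* As [enorm (G x) <= L * enorm (x - xb)], this radius gives [enorm (x - xb) + enorm (G x) < delta],
   and the sum dominates the Euclidean norm of the pair. *)
exists (Num.min eta (delta / (L + 1))); split; first by rewrite lt_min eta0 divr_gt0.
move=> x; rewrite lt_min => /andP[xeta].
rewrite ltr_pdivlMr// => xdelta.
have [fGx GxL _ _] := near_xb x xeta.
apply: (d2_unique_min c0 L0 _ _ xeta).
- by move=> y z /near_xb[_ _ + _] => /[apply].
- by move=> y z /near_xb[_ _ _] => /[apply].
apply: epi => //; set s := enorm (x - xb) in xdelta GxL *.
have s0 : 0 <= s := enorm_ge0 _; have g0 := enorm_ge0 (G x).
apply: (@le_trans _ _ (s + enorm (G x))); last by lra.
rewrite -[leRHS](ger0_norm (addr_ge0 s0 g0)) -sqrtr_sqr ler_sqrt ?sqr_ge0//.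
by rewrite sqrrD; have := mulr_ge0 s0 g0; lra.
Qed.
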